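(* Let $L(V)$ be the Kantor Lie-double of the Virasoro-like algebra, and let $\Delta_{\overline 0}(L(V))$ be the space of even $\frac12$-superderivations of $L(V)$. Then $\Delta_{\overline 0}(L(V))=\langle \mathrm{id}\rangle$, the one-dimensional complex space spanned by the identity map of $L(V)$.
   Context: For $\mathbf{m}=(m_1,m_2),\mathbf{n}=(n_1,n_2)\in\mathbb{Z}^2$ write $\det\binom{\mathbf{n}}{\mathbf{m}}=n_1m_2-n_2m_1$. The Kantor Lie-double $L(V)=L(V)_{\overline 0}\oplus L(V)_{\overline 1}$ of the Virasoro-like algebra is the complex Lie superalgebra whose even part $L(V)_{\overline 0}$ has basis $\{L_{\mathbf{m}}\mid\mathbf{m}\in\mathbb{Z}^2\setminus\{\mathbf{0}\}\}$, whose odd part $L(V)_{\overline 1}$ has basis $\{G_{\mathbf{m}}\mid\mathbf{m}\in\mathbb{Z}^2\setminus\{\mathbf{0}\}\}$, and whose bracket is $[L_{\mathbf{m}},L_{\mathbf{n}}]=\det\binom{\mathbf{n}}{\mathbf{m}}L_{\mathbf{m}+\mathbf{n}}$, $[L_{\mathbf{m}},G_{\mathbf{n}}]=\det\binom{\mathbf{n}}{\mathbf{m}}G_{\mathbf{m}+\mathbf{n}}=[G_{\mathbf{m}},L_{\mathbf{n}}]$, $[G_{\mathbf{m}},G_{\mathbf{n}}]=L_{\mathbf{m}+\mathbf{n}}$, with the convention $L_{\mathbf{0}}=0$, $G_{\mathbf{0}}=0$. For $\delta\in\mathbb{C}$, a $\delta$-superderivation of a Lie superalgebra $L$ is a homogeneous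 (with respect to the $\mathbb{Z}_2$-grading) linear map $D:L\to L$ of degree $|D|$ with $D([x,y])=\delta([D(x),y]+(-1)^{|D||x|}[x,D(y)])$ for all homogeneous $x,y\in L$. It is even if $|D|=\overline 0$, i.e. $D(L_{\overline 0})\subseteq L_{\overline 0}$ and $D(L_{\overline 1})\subseteq L_{\overline 1}$. *)

(* Defs.v *)
From HB Require Import structures.
From mathcomp Require Import all_boot all_order all_algebra finmap.
From mathcomp Require Import ring.
From mathcomp Require Import boolp classical_sets functions reals.
From mathcomp Require Import complex monalg.

Set Implicit Arguments.
Unset Strict Implicit.
Unset Printing Implicit Defensive.
Import Order.TTheory GRing.Theory Num.Theory.
Local Open Scope classical_set_scope.
Local Open Scope ring_scope.

(* Elements of Z/2 are booleans: [false] is the even degree, [true] the odd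
   one, [(+)] the addition and [&&] the multiplication. *)
Record lieSuperalgebra (K : numFieldType) := LieSuperalgebra {
  carrier :> lmodType K;
  part : bool -> set carrier;
  bracket : carrier -> carrier -> carrier;
  part_submod : forall p, part p 0 /\
    forall (c : K) x y, part p x -> part p y -> part p (c *: x + y);
  part_cover : forall x,
    exists x0 x1, [/\ part false x0, part true x1 & x = x0 + x1];
  part_direct : forall x, part false x -> part true x -> x = 0;
  bracket_linearl : forall y, linear (bracket ^~ y);
  bracket_linearr : forall x, linear (bracket x);
  bracket_part : forall p q x y,
    part p x -> part q y -> part (p (+) q) (bracket x y);
  bracket_skew : forall p q x y, part p x -> part q y ->
    bracket x y = - ((-1) ^+ (p && q) *: bracket y x);
  bracket_jacobi : forall p q r x y z, part p x -> part q y -> part r z ->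
    bracket x (bracket y z) =
      bracket (bracket x y) z + (-1) ^+ (p && q) *: bracket y (bracket x z)
}.

Definition superderivation (K : numFieldType) (L : lieSuperalgebra K)
    (delta : K) (d : bool) (D : L -> L) : Prop :=
  [/\ linear D,
      forall p x, part p x -> part (d (+) p) (D x) &
      forall p q x y, part p x -> part q y ->
        D (bracket x y) =
          delta *: (bracket (D x) y + (-1) ^+ (d && p) *: bracket x (D y))].

Definition Delta_even (K : numFieldType) (L : lieSuperalgebra K) :
    set (L -> L) :=
  [set D | superderivation 2^-1 false D].
Arguments Delta_even {K} L.

Section BilinearExtension.
Context (K : numFieldType) (I : choiceType) (b : I -> I -> {malg K[I]}).

Definition bilinear_ext (x y : {malg K[I]}) : {malg K[I]} :=
  \sum_(i <- msupp x) \sum_(j <- msupp y) (x@_i * y@_j) *: b i j.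

Lemma bilinear_extw (d1 d2 : {fset I}) x y :
  (msupp x `<=` d1)%fset -> (msupp y `<=` d2)%fset ->
  bilinear_ext x y = \sum_(i <- d1) \sum_(j <- d2) (x@_i * y@_j) *: b i j.
Proof.
move=> h1 h2; rewrite /bilinear_ext (big_fset_incl _ h1) /=.
  apply: eq_bigr => i _; apply: big_fset_incl => // j _ /mcoeff_outdom ->.
  by rewrite mulr0 scale0r.
move=> i _ /mcoeff_outdom ->.
by rewrite big1 // => j _; rewrite mul0r scale0r.
Qed.

Lemma bilinear_ext_linearl y : linear (bilinear_ext ^~ y).
Proof.
move=> c u v /=.
have hu : (msupp u `<=` msupp u `|` msupp v)%fset by apply: fsubsetUl.
have hv : (msupp v `<=` msupp u `|` msupp v)%fset by apply: fsubsetUr.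
have hw : (msupp (c *: u + v) `<=` msupp u `|` msupp v)%fset.
  by apply: fsubset_trans (msuppD_le _ _) _; apply/fsetSU/msuppZ_le.
have hy := fsubset_refl (msupp y).
rewrite (bilinear_extw hu hy) (bilinear_extw hv hy) (bilinear_extw hw hy).
rewrite scaler_sumr -big_split; apply: eq_bigr => i _ /=.
rewrite scaler_sumr -big_split; apply: eq_bigr => j _ /=.
by rewrite mcoeffD mcoeffZ mulrDl scalerDl scalerA mulrA.
Qed.

Lemma bilinear_ext_linearr x : linear (bilinear_ext x).
Proof.
move=> c u v /=.
have hu : (msupp u `<=` msupp u `|` msupp v)%fset by apply: fsubsetUl.
have hv : (msupp v `<=` msupp u `|` msupp v)%fset by apply: fsubsetUr.
have hw : (msupp (c *: u + v) `<=` msupp u `|` msupp v)%fset.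
  by apply: fsubset_trans (msuppD_le _ _) _; apply/fsetSU/msuppZ_le.
have hx := fsubset_refl (msupp x).
rewrite (bilinear_extw hx hu) (bilinear_extw hx hv) (bilinear_extw hx hw).
rewrite scaler_sumr -big_split; apply: eq_bigr => i _ /=.
rewrite scaler_sumr -big_split; apply: eq_bigr => j _ /=.
by rewrite mcoeffD mcoeffZ mulrDr scalerDl scalerA mulrCA.
Qed.

Lemma bilinear_extU i j : bilinear_ext << i >> << j >> = b i j.
Proof.
rewrite (bilinear_extw msuppU_le msuppU_le) !big_seq_fset1 !mcoeffUU.
by rewrite mul1r scale1r.
Qed.

Lemma eq_linear_malg (V : lmodType K) (f g : {malg K[I]} -> V) (P : pred I) :
  linear f -> linear g -> (forall i, P i -> f << i >> = g << i >>) ->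
  forall x, {in msupp x, forall i, P i} -> f x = g x.
Proof.
move=> lf lg fg x Px.
pose mf := GRing.isLinear.Build K {malg K[I]} V *:%R f lf.
pose mg := GRing.isLinear.Build K {malg K[I]} V *:%R g lg.
pose F : {linear {malg K[I]} -> V} := HB.pack f mf.
pose G : {linear {malg K[I]} -> V} := HB.pack g mg.
have E : x = \sum_(i <- msupp x) x@_i *: << i >>.
  rewrite {1}[x]monalgE; apply: eq_bigr => i _; apply/malgP => k.
  by rewrite mcoeffZ !mcoeffU mulrnAr mulr1.
suff : F x = G x by [].
rewrite E !linear_sum; apply: eq_big_seq => i /Px Pi.
by rewrite !linearZ; congr (_ *: _); apply: fg.
Qed.

End BilinearExtension.

Definition nzZ2 := {m : int * int | m != 0}.

(* The determinant of the 2x2 matrix with rows n and m. *)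
Definition det2 (n m : int * int) : int := n.1 * m.2 - n.2 * m.1.

Section KantorDouble.
Context (K : numFieldType).

(* Free vector space on the L_m (indices (false, m)) and the G_m
   (indices (true, m)), m nonzero. *)
Definition LV_carrier := {malg K[(bool * nzZ2)%type]}.
HB.instance Definition _ := GRing.Lmodule.on LV_carrier.

(* [LG false m] is L_m and [LG true m] is G_m, with L_0 = G_0 = 0. *)
Definition LG (p : bool) (m : int * int) : LV_carrier :=
  if insub m is Some u then << (p, u) >> else 0.

Definition Lm := LG false.
Definition Gm := LG true.

Definition LV_basis_bracket (a b : bool * nzZ2) : LV_carrier :=
  let m := val a.2 in let n := val b.2 in
  match a.1, b.1 with
  | false, false => (det2 n m)%:~R *: Lm (m + n)
  | false, true | true, false => (det2 n m)%:~R *: Gm (m + n)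
  | true, true => Lm (m + n)
  end.

Definition LV_bracket : LV_carrier -> LV_carrier -> LV_carrier :=
  bilinear_ext LV_basis_bracket.

Definition LV_part (p : bool) : set LV_carrier :=
  [set x | {in msupp x, forall k, k.1 = p}].

Lemma LG0 p : LG p 0 = 0.
Proof. by rewrite /LG insubF // eqxx. Qed.

Lemma LGval p (u : nzZ2) : LG p (val u) = << (p, u) >>.
Proof. by rewrite /LG valK. Qed.

Definition coefLG p q (m n : int * int) : int :=
  if p && q then ((m != 0) && (n != 0) : nat)%:Z else det2 n m.

Lemma LV_bracketE p q m n :
  LV_bracket (LG p m) (LG q n) =
    (coefLG p q m n)%:~R *: LG (p (+) q) (m + n).
Proof.
have l0 y : LV_bracket 0 y = 0.
  by rewrite /LV_bracket /bilinear_ext msupp0 big_seq_fset0.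
have r0 x : LV_bracket x 0 = 0.
  rewrite /LV_bracket /bilinear_ext big1 // => i _.
  by rewrite msupp0 big_seq_fset0.
have [->|m0] := eqVneq m 0.
  rewrite LG0 l0 /coefLG eqxx /det2 /= !mulr0 subrr.
  by case: (p && q); rewrite scale0r.
have [->|n0] := eqVneq n 0.
  rewrite LG0 r0 /coefLG eqxx andbF /det2 /= !mul0r subrr.
  by case: (p && q); rewrite scale0r.
have -> : m = val (Sub m m0 : nzZ2) by [].
have -> : n = val (Sub n n0 : nzZ2) by [].
rewrite !LGval /LV_bracket bilinear_extU /LV_basis_bracket /coefLG.
by case: p; case: q; rewrite ?SubK ?m0 ?n0 //= scale1r.
Qed.

Lemma LV_bracketLL m n :
  LV_bracket (Lm m) (Lm n) = (det2 n m)%:~R *: Lm (m + n).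
Proof. exact: LV_bracketE. Qed.

Lemma LV_bracketLG m n :
  LV_bracket (Lm m) (Gm n) = (det2 n m)%:~R *: Gm (m + n).
Proof. exact: LV_bracketE. Qed.

Lemma LV_bracketGL m n :
  LV_bracket (Gm m) (Lm n) = (det2 n m)%:~R *: Gm (m + n).
Proof. exact: LV_bracketE. Qed.

Lemma LV_bracketGG m n : m != 0 -> n != 0 ->
  LV_bracket (Gm m) (Gm n) = Lm (m + n).
Proof. by move=> m0 n0; rewrite LV_bracketE /coefLG m0 n0 scale1r. Qed.

Lemma LV_partP p x :
  LV_part p x <-> forall k : bool * nzZ2, k.1 != p -> x@_k = 0.
Proof.
split=> h k kp.
  by apply: mcoeff_outdom; apply: contra kp => /h ->.
by apply/eqP/negPn/negP => /h /eqP; rewrite mcoeff_eq0 kp.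
Qed.

Lemma LV_part_submod p : LV_part p 0 /\
  forall (c : K) x y, LV_part p x -> LV_part p y -> LV_part p (c *: x + y).
Proof.
split; first by apply/LV_partP => k _; rewrite mcoeff0.
move=> c x y /LV_partP hx /LV_partP hy; apply/LV_partP => k kp.
by rewrite mcoeffD mcoeffZ hx // hy // mulr0 addr0.
Qed.

Lemma LV_part_LG p m : LV_part p (LG p m).
Proof.
rewrite /LG; case: insub => [u|]; last exact: (LV_part_submod p).1.
by apply/LV_partP => k kp; rewrite mcoeffU; have [E|//] := eqVneq;
  rewrite -E eqxx in kp.
Qed.

Lemma LV_partZ p (c : K) x : LV_part p x -> LV_part p (c *: x).
Proof.
by move=> hx; rewrite -[_ *: _]addr0; apply: (LV_part_submod p).2 => //;
  exact: (LV_part_submod p).1.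
Qed.

Lemma LV_part_cover x :
  exists x0 x1, [/\ LV_part false x0, LV_part true x1 & x = x0 + x1].
Proof.
pose c p : LV_carrier := [malg k in msupp x => if k.1 == p then x@_k else 0].
have cE p k : (c p)@_k = if k.1 == p then x@_k else 0.
  by rewrite mcoeffE; case: msuppP => //; rewrite if_same.
exists (c false), (c true); split.
- by apply/LV_partP => k kp; rewrite cE (negbTE kp).
- by apply/LV_partP => k kp; rewrite cE (negbTE kp).
- by apply/malgP => k; rewrite mcoeffD !cE; case: k.1; rewrite ?addr0 ?add0r.
Qed.

Lemma LV_part_direct x : LV_part false x -> LV_part true x -> x = 0.
Proof.
move=> /LV_partP h0 /LV_partP h1; apply/malgP => k; rewrite mcoeff0.
by case E : k.1; [apply: h0 | apply: h1]; rewrite E.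
Qed.

Lemma LV_bracket_linearl y : linear (LV_bracket ^~ y).
Proof. exact: bilinear_ext_linearl. Qed.

Lemma LV_bracket_linearr x : linear (LV_bracket x).
Proof. exact: bilinear_ext_linearr. Qed.

Lemma LV_bracket_part p q x y :
  LV_part p x -> LV_part q y -> LV_part (p (+) q) (LV_bracket x y).
Proof.
move=> hx hy; have [part0 partD] := LV_part_submod (p (+) q).
have addP u v : LV_part (p (+) q) u -> LV_part (p (+) q) v ->
    LV_part (p (+) q) (u + v).
  by move=> hu hv; rewrite -[u]scale1r; apply: partD.
rewrite /LV_bracket /bilinear_ext big_seq; elim/big_ind: _ => // i /hx ip.
rewrite big_seq; elim/big_ind: _ => // j /hy jq; apply: LV_partZ.
rewrite -[X in LV_part _ X]bilinear_extU.
case: i j ip jq => [_ u] [_ v] /= -> ->; rewrite -!LGval.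
rewrite -/(LV_bracket _ _) LV_bracketE.
exact/LV_partZ/LV_part_LG.
Qed.

Let LV_ext (V : lmodType K) p (f g : LV_carrier -> V) :
  linear f -> linear g -> (forall m, f (LG p m) = g (LG p m)) ->
  forall x, LV_part p x -> f x = g x.
Proof.
move=> lf lg fg x hx.
apply: (eq_linear_malg (P := fun k => k.1 == p) lf lg) => [[_ u] /= /eqP->|k].
  by rewrite -LGval.
by move=> /hx ->.
Qed.

Lemma LV_bracket_skew p q x y : LV_part p x -> LV_part q y ->
  LV_bracket x y = - ((-1) ^+ (p && q) *: LV_bracket y x).
Proof.
move=> + hy; move: x; apply: LV_ext => [||m].
- exact: LV_bracket_linearl.
- move=> c u v /=; rewrite LV_bracket_linearr scalerDr opprD scalerN.
  by rewrite !scalerA mulrC.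
move: y hy; apply: LV_ext => [||n].
- exact: LV_bracket_linearr.
- move=> c u v /=; rewrite LV_bracket_linearl scalerDr opprD scalerN.
  by rewrite !scalerA mulrC.
rewrite !LV_bracketE [n + m]addrC [q (+) p]addbC scalerA -scaleNr.
congr (_ *: _); rewrite /coefLG [q && p]andbC [(n != 0) && _]andbC.
case: (p && q) => /=; first by rewrite expr1 mulN1r opprK.
by rewrite expr0 mul1r -rmorphN; congr (_%:~R); rewrite /det2; ring.
Qed.

Lemma LV_bracket_jacobi p q r x y z :
  LV_part p x -> LV_part q y -> LV_part r z ->
  LV_bracket x (LV_bracket y z) =
    LV_bracket (LV_bracket x y) z +
    (-1) ^+ (p && q) *: LV_bracket y (LV_bracket x z).
Proof.
have lin2 (a : K) (c : K) (u v u' v' : LV_carrier) :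
    c *: u + v + a *: (c *: u' + v') = c *: (u + a *: u') + (v + a *: v').
  by rewrite !scalerDr !scalerA [a * c]mulrC addrACA.
move=> + hy hz; move: x; apply: LV_ext => [||m].
- by move=> c u v /=; rewrite LV_bracket_linearl.
- move=> c u v /=.
  by rewrite !(LV_bracket_linearl, LV_bracket_linearr) /= lin2.
move: y hy; apply: LV_ext => [||n].
- move=> c u v /=.
  by rewrite !(LV_bracket_linearl, LV_bracket_linearr).
- move=> c u v /=.
  by rewrite !(LV_bracket_linearl, LV_bracket_linearr) /= lin2.
move: z hz; apply: LV_ext => [||k].
- by move=> c u v /=; rewrite !LV_bracket_linearr.
- move=> c u v /=.
  by rewrite !LV_bracket_linearr /= lin2.
have brZl (c : K) u v : LV_bracket (c *: u) v = c *: LV_bracket u v.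
  pose mf := GRing.isLinear.Build K LV_carrier LV_carrier *:%R _
    (LV_bracket_linearl v).
  pose F : {linear LV_carrier -> LV_carrier} := HB.pack (LV_bracket ^~ v) mf.
  by suff : F (c *: u) = c *: F u by []; rewrite linearZ.
have brZr (c : K) u v : LV_bracket u (c *: v) = c *: LV_bracket u v.
  pose mf := GRing.isLinear.Build K LV_carrier LV_carrier *:%R _
    (LV_bracket_linearr u).
  pose F : {linear LV_carrier -> LV_carrier} := HB.pack (LV_bracket u) mf.
  by suff : F (c *: v) = c *: F v by []; rewrite linearZ.
rewrite !LV_bracketE !brZl !brZr !LV_bracketE !scalerA.
rewrite [n + (m + k)]addrCA !addbA [q (+) p]addbC addrA -scalerDl.
congr (_ *: _).
have -> : (-1) ^+ (p && q) = ((-1) ^+ (p && q))%:~R :> K.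
  by rewrite rmorphXn rmorphN1.
rewrite -!rmorphM -rmorphD; congr (_%:~R).
have detI a b : det2 a b * ((b + a != 0) : nat)%:Z = det2 a b.
  have [|_] := eqVneq (b + a) 0; last by rewrite mulr1.
  by move/eqP; rewrite addr_eq0 => /eqP ->; rewrite /det2 /=; ring.
have det0l a : det2 0 a = 0 by rewrite /det2 /=; ring.
have det0r a : det2 a 0 = 0 by rewrite /det2 /=; ring.
rewrite /coefLG; case: p; case: q; case: r; rewrite /= -?mulnb ?PoszM.
all: have [->|m0] := eqVneq m 0; have [->|n0] := eqVneq n 0;
  have [->|k0] := eqVneq k 0.
all: rewrite -?mulrA /= ?mul1r ?mulr1 ?detI.
all: rewrite ?(addr0, add0r) ?eqxx ?m0 ?n0 ?k0.
all: by rewrite /det2 /=; ring.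
Qed.

Definition LV : lieSuperalgebra K :=
  LieSuperalgebra LV_part_submod LV_part_cover LV_part_direct
    LV_bracket_linearl LV_bracket_linearr LV_bracket_part LV_bracket_skew
    LV_bracket_jacobi.

End KantorDouble.

(* Main.v *)
(* Decompose an even 1/2-superderivation D by degree: D(L_m) has coefficient
   a(m) at L_(m+k), and 2 det(n,m) a(m+n) = det(n,m+k) a(m) + det(n+k,m) a(n).
   For k <> 0, taking n parallel to m shows that a is homogeneous on the lines
   not parallel to k; scaling m and n by 2 then separates the terms of the
   relation by degree, which forces a = 0.  For k = 0 the relation says that a
   is a midpoint function on independent pairs, hence constant.  On the odd part
   [G_m,G_n] = L_(m+n) gives b(m) + b(n) = 2 a(m+n), so b = a. *)
Require Import Defs.
From mathcomp Require Import all_boot all_order all_algebra.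
From mathcomp Require Import ring zify.
From mathcomp Require Import boolp classical_sets functions reals.
From mathcomp Require Import complex monalg.
Import GRing.Theory Num.Theory.
Local Open Scope classical_set_scope.
Local Open Scope ring_scope.

(** * Bilinearity and antisymmetry of the determinant *)

Lemma det2Dl u v w : det2 (u + v) w = det2 u w + det2 v w.
Proof. by rewrite /det2 /=; ring. Qed.

Lemma det2Dr u v w : det2 w (u + v) = det2 w u + det2 w v.
Proof. by rewrite /det2 /=; ring. Qed.

Lemma det2xx u : det2 u u = 0.
Proof. by rewrite /det2; ring. Qed.

Lemma det2l0 u : det2 0 u = 0.
Proof. by rewrite /det2 /=; ring. Qed.

Lemma det2r0 u : det2 u 0 = 0.
Proof. by rewrite /det2 /=; ring. Qed.

Lemma det2C u v : det2 u v = - det2 v u.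
Proof. by rewrite /det2; ring. Qed.

(** * Scalar functions satisfying the degree-[k] relation *)

Section HalfDerivationCoefficients.
Context (K : numFieldType).
Implicit Types (a : int * int -> K) (m n k : int * int).

Definition half_der_rel k a := forall m n,
  2 * (det2 n m)%:~R * a (m + n) =
    (det2 n (m + k))%:~R * a m + (det2 (n + k) m)%:~R * a n.

Let eq_lincomb {c l r : K} e1 e2 : l = r -> e1 - e2 = c * (l - r) -> e1 = e2.
Proof. by move=> -> /eqP; rewrite subrr mulr0 subr_eq0 => /eqP. Qed.

Let dDl u v w : (det2 (u + v) w)%:~R = (det2 u w)%:~R + (det2 v w)%:~R :> K.
Proof. by rewrite det2Dl intrD. Qed.

Let dDr u v w : (det2 w (u + v))%:~R = (det2 w u)%:~R + (det2 w v)%:~R :> K.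
Proof. by rewrite det2Dr intrD. Qed.

Let dxx u : (det2 u u)%:~R = 0 :> K.
Proof. by rewrite det2xx. Qed.

Let dC u v : (det2 u v)%:~R = - (det2 v u)%:~R :> K.
Proof. by rewrite det2C mulrNz. Qed.

Section NonzeroShift.
Context (k : int * int) (a : int * int -> K).
Hypothesis rel_a : half_der_rel k a.

Let two_neq0 : 2 != 0 :> K.
Proof. by rewrite pnatr_eq0. Qed.

Lemma half_der_double m : det2 m k != 0 -> a (m + m) = 2 * a m.
Proof.
rewrite -(intr_eq0 K) => mk.
(* With [n = m + m] the left side carries [det2 (m + m) m = 0]. *)
have R2 := rel_a m (m + m).
rewrite !(dDl, dDr, dxx) (dC k m) in R2.
apply: (mulfI mk); apply: (eq_lincomb (c := 1) _ _ R2). ring.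
Qed.

(** Subtracting 8 times the relation at [m, n] from the one at [2m, 2n] cancels [a (m + n)] and all
    [det2 n m] terms, leaving the proportionality; put back into the relation, it gives the midpoint
    rule. *)
Lemma half_der_split m n : det2 m k != 0 -> det2 n k != 0 ->
    det2 (m + n) k != 0 ->
  (det2 n k)%:~R * a m = (det2 m k)%:~R * a n /\
  (det2 n m != 0 -> 2 * a (m + n) = a m + a n).
Proof.
move=> mk nk mnk.
have R1 := rel_a m n; have R2 := rel_a (m + m) (n + n).
have E : m + m + (n + n) = m + n + (m + n) by rewrite addrACA.
rewrite E !half_der_double // in R2.
move: R1 R2; rewrite !(dDl, dDr) (dC k m).
set x := (det2 n k)%:~R; set y := (det2 m k)%:~R; set d := (det2 n m)%:~R.
move=> R1 R2.
have xy : x * a m = y * a n.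
  apply: (mulfI two_neq0); apply: (mulfI two_neq0).
  by apply: (eq_lincomb (c := 1) _ _ (congr2 +%R R2 (congr1 ( *%R (- 8)) R1))); ring.
split=> // nm.
have d0 : d != 0 by rewrite intr_eq0.
apply: (mulfI d0); apply: (eq_lincomb (c := 1) _ _ (congr2 +%R R1 xy)); ring.
Qed.

(** Splitting at [m, m + k] gives [a (m + k) = a m], then [a (2m + k) = a m]; splitting at
    [m, 2m + k] gives [2 * a m = a (2m + k)]. *)
Lemma half_der_eq0_transverse m : det2 m k != 0 -> a m = 0.
Proof.
move=> mk.
have km : det2 (m + k) m != 0 by rewrite det2Dl det2xx add0r det2C oppr_eq0.
have E1 : det2 (m + k) k = det2 m k by rewrite det2Dl det2xx addr0.
have E2 : det2 (m + (m + k)) k = det2 m k *+ 2 by rewrite det2Dl E1.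
have E3 : det2 (m + (m + (m + k))) k = det2 m k *+ 3 by rewrite det2Dl E2.
have mkK : (det2 m k)%:~R != 0 :> K by rewrite intr_eq0.
have [] := half_der_split m (m + k) mk.
- by rewrite E1.
- by rewrite E2 mulrn_eq0.
rewrite E1 => /(mulfI mkK) <- /(_ km).
have -> : a m + a m = 2 * a m by ring.
move=> /(mulfI two_neq0) a2.
have [] := half_der_split m (m + (m + k)) mk.
- by rewrite E2 mulrn_eq0.
- by rewrite E3 mulrn_eq0.
rewrite E2 a2 => H _; apply: (mulfI mkK).
by rewrite rmorphMn /= in H; apply: (eq_lincomb (c := 1) _ _ H); ring.
Qed.

(** A nonzero [m] parallel to [k] is a sum of two independent vectors transverse to [k], where [a]
    already vanishes. *)
Lemma half_der_eq0 : k != 0 -> a 0 = 0 -> forall m, a m = 0.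
Proof.
move=> k0 a0 m.
have [->//|m0] := eqVneq m 0.
have [mk|] := eqVneq (det2 m k) 0; last exact: half_der_eq0_transverse.
(* [p] is [k] turned by a right angle: [det2 p k] is minus the squared length of [k]. *)
pose p : int * int := (- k.2, k.1).
have kk : k.1 * k.1 + k.2 * k.2 != 0.
  apply: contraNneq k0 => E; apply/eqP; case: k E => k1 k2 /= E.
  by congr (_, _); nia.
have pk : det2 p k != 0 by rewrite /det2 /=; lia.
have mpk : det2 (m - p) k != 0.
  by move: pk mk; rewrite /det2 /=; lia.
(* This determinant is the scalar product of [m] and [k]; if it vanished along with [det2 m k], then
   [m] would be 0. *)
have mp : det2 (m - p) p != 0.
  apply: contraNneq m0 => E; apply/eqP.
  have E' : m.1 * k.1 + m.2 * k.2 = 0 by move: E; rewrite /det2 /=; lia.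
  move: mk; rewrite /det2 => mk.
  have m1 : m.1 * (k.1 * k.1 + k.2 * k.2) = 0.
    have -> : m.1 * (k.1 * k.1 + k.2 * k.2) =
      k.1 * (m.1 * k.1 + m.2 * k.2) + k.2 * (m.1 * k.2 - m.2 * k.1) by ring.
    by rewrite E' mk !mulr0.
  have m2 : m.2 * (k.1 * k.1 + k.2 * k.2) = 0.
    have -> : m.2 * (k.1 * k.1 + k.2 * k.2) =
      k.2 * (m.1 * k.1 + m.2 * k.2) - k.1 * (m.1 * k.2 - m.2 * k.1) by ring.
    by rewrite E' mk !mulr0 subr0.
  move/eqP: m1; rewrite mulf_eq0 (negbTE kk) orbF => /eqP m1.
  move/eqP: m2; rewrite mulf_eq0 (negbTE kk) orbF => /eqP m2.
  by case: m m1 m2 {E E' mk mpk} => ? ? /= -> ->.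
have := rel_a p (m - p).
rewrite (half_der_eq0_transverse p) // (half_der_eq0_transverse (m - p)) //.
rewrite !mulr0 addr0 subrKC => /eqP.
by rewrite !mulf_eq0 (negbTE two_neq0) intr_eq0 (negbTE mp) => /eqP.
Qed.

End NonzeroShift.

(** Reading [2 * a (m + 2n)] as a midpoint value in two ways expresses [a m] through [a n] and
    [a (2n)], so [a] is constant on the vectors independent of a fixed [n]. *)
Lemma half_der_const a : half_der_rel 0 a -> forall m, m != 0 -> a m = a (1, 1).
Proof.
move=> rel_a.
have mid m n : det2 n m != 0 -> 2 * a (m + n) = a m + a n.
  rewrite -(intr_eq0 K) => nm; apply: (mulfI nm).
  by have := rel_a m n; rewrite !addr0 => H; apply: (eq_lincomb (c := 1) _ _ H); ring.
have away m n : det2 n m != 0 -> a m = 3 * a n - 2 * a (n + n).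
  move=> nm.
  have H1 := mid _ _ nm.
  have H2 : 2 * a (m + n + n) = a (m + n) + a n.
    by apply: mid; rewrite det2Dr det2xx addr0.
  have H3 : 2 * a (m + n + n) = a m + a (n + n).
    by rewrite -addrA; apply: mid; rewrite det2Dl -mulr2n mulrn_eq0.
  have H := congr2 +%R H1 (congr2 +%R (congr1 ( *%R 2) H2) (congr1 ( *%R (- 2)) H3)).
  by apply: (eq_lincomb (c := 1) _ _ H); ring.
move=> m m0.
(* [m] and [(1, 1)] are compared through an axis vector independent of both. *)
have [m2|m2] := eqVneq m.2 0.
  have m1 : m.1 != 0.
    by apply: contraNneq m0 => m1; case: m m1 m2 => ? ? /= -> ->.
  rewrite (away m (0, 1)); last by rewrite /det2 /=; lia.
  by rewrite (away (1, 1) (0, 1)).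
rewrite (away m (1, 0)); last by rewrite /det2 /=; lia.
by rewrite (away (1, 1) (1, 0)).
Qed.

End HalfDerivationCoefficients.

(** * Coefficient functionals and the bracket *)

Section KantorDoubleCoefficients.
Context (K : numFieldType).
Implicit Types (p q : bool) (m n v k : int * int) (x y : LV_carrier K).

(* Coefficient of L_v or G_v, with value 0 at v = 0, matching L_0 = G_0 = 0. *)
Definition LGcoef p v x : K := if insub v is Some u then x@_(p, u) else 0.

Lemma LGcoef0 p x : LGcoef p 0 x = 0.
Proof. by rewrite /LGcoef insubF // eqxx. Qed.

Lemma LGcoefD p v x y : LGcoef p v (x + y) = LGcoef p v x + LGcoef p v y.
Proof. by rewrite /LGcoef; case: insub => [u|]; rewrite ?addr0 ?mcoeffD. Qed.

Lemma LGcoefZ p v (c : K) x : LGcoef p v (c *: x) = c * LGcoef p v x.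
Proof. by rewrite /LGcoef; case: insub => [u|]; rewrite ?mulr0 ?mcoeffZ. Qed.

Lemma LGcoef_LG p q v m :
  LGcoef p v (LG K q m) = ((p == q) && (v == m) && (m != 0))%:R.
Proof.
have [->|m0] := eqVneq m 0.
  by rewrite LG0 andbF /LGcoef; case: insub => // u; rewrite mcoeff0.
have [->|v0] := eqVneq v 0.
  by rewrite LGcoef0 (eq_sym 0) (negbTE m0) andbF.
rewrite andbT; have -> : m = val (Sub m m0 : nzZ2) by [].
have -> : v = val (Sub v v0 : nzZ2) by [].
rewrite LGval /LGcoef valK mcoeffU val_eqE.
by rewrite eq_sym xpair_eqE.
Qed.

Lemma LGcoef_eq p x y : LV_part p x -> LV_part p y ->
  (forall v, LGcoef p v x = LGcoef p v y) -> x = y.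
Proof.
move=> /LV_partP px /LV_partP py xy; apply/malgP => -[q u].
have [->|qp] := eqVneq q p; last by rewrite px ?py.
by have := xy (val u); rewrite /LGcoef valK.
Qed.

Lemma LV_part_ext p (V : lmodType K) (f g : LV_carrier K -> V) :
  linear f -> linear g -> (forall m, f (LG K p m) = g (LG K p m)) ->
  forall x, LV_part p x -> f x = g x.
Proof.
move=> lf lg fg x hx.
apply: (eq_linear_malg (P := fun i => i.1 == p) lf lg) => [[_ u] /= /eqP->|i].
  by rewrite -LGval.
by move=> /hx ->.
Qed.

(* This and the next lemma fail at v = 0 for p = q = true: [G_n, G_(-n)] = L_0 = 0. *)
Lemma LGcoef_bracketl p q n v x : v != 0 -> LV_part p x ->
  LGcoef (p (+) q) v (LV_bracket x (LG K q n)) =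
    (coefLG p q (v - n) n)%:~R * LGcoef p (v - n) x.
Proof.
move=> v0; pose f y : K^o := LGcoef (p (+) q) v (LV_bracket y (LG K q n)).
pose g y : K^o := (coefLG p q (v - n) n)%:~R * LGcoef p (v - n) y.
apply: (@LV_part_ext p _ f g) => [c y z|c y z|m].
- by rewrite /f LV_bracket_linearl LGcoefD LGcoefZ.
- by rewrite /g LGcoefD LGcoefZ mulrDr mulrCA.
rewrite /f /g LV_bracketE LGcoefZ !LGcoef_LG !eqxx /= subr_eq.
have [vE|_] := eqVneq v (m + n); last by rewrite /= !mulr0.
rewrite vE addrK -vE v0 mulr1 /coefLG.
have [->|m0] := eqVneq m 0; last by rewrite mulr1.
by rewrite det2r0; case: (p && q); rewrite mul0r.
Qed.

Lemma LGcoef_bracketr p q m v y : v != 0 -> LV_part q y ->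
  LGcoef (p (+) q) v (LV_bracket (LG K p m) y) =
    (coefLG p q m (v - m))%:~R * LGcoef q (v - m) y.
Proof.
move=> v0; pose f y : K^o := LGcoef (p (+) q) v (LV_bracket (LG K p m) y).
pose g y : K^o := (coefLG p q m (v - m))%:~R * LGcoef q (v - m) y.
apply: (@LV_part_ext q _ f g) => [c w z|c w z|n].
- by rewrite /f LV_bracket_linearr LGcoefD LGcoefZ.
- by rewrite /g LGcoefD LGcoefZ mulrDr mulrCA.
rewrite /f /g LV_bracketE LGcoefZ !LGcoef_LG !eqxx /= subr_eq addrC.
have [vE|_] := eqVneq v (n + m); last by rewrite /= !mulr0.
rewrite vE addrK -vE v0 mulr1 /coefLG.
have [->|n0] := eqVneq n 0; last by rewrite mulr1.
by rewrite det2l0 andbF; case: (p && q); rewrite mul0r.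
Qed.

(** * Degree components of an even half-superderivation *)

Section EvenHalfSuperderivation.
Context (D : LV K -> LV K).
Hypothesis half_D : superderivation 2^-1 false D.

(** The component of [D] of [Z^2]-degree [k], as one scalar per basis vector. *)
Definition shift_coef p k m : K := LGcoef p (m + k) (D (LG K p m)).

Let D_linear : linear D.
Proof. by case: half_D. Qed.

Let D_part p m : LV_part p (D (LG K p m)).
Proof. by case: half_D => _ H _; apply/(H p)/LV_part_LG. Qed.

Let D_Z (c : K) x : D (c *: x) = c *: D x.
Proof. exact: (GRing.scalable_linear D_linear). Qed.

Let D_0 : D 0 = 0.
Proof. by rewrite -[in LHS](scale0r 0) D_Z scale0r. Qed.

Lemma shift_coef0 p k : shift_coef p k 0 = 0.
Proof.
by rewrite /shift_coef LG0 D_0 /LGcoef; case: insub => // u; rewrite mcoeff0.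
Qed.

Lemma shift_coefN p k m : m + k = 0 -> shift_coef p k m = 0.
Proof. by rewrite /shift_coef => ->; rewrite LGcoef0. Qed.

(** Compares coefficients at [m + n + k] in the identity for two basis vectors; [D] is even, so no
    sign appears. *)
Lemma shift_coefE p q k m n : m + n + k != 0 ->
  2 * (coefLG p q m n)%:~R * shift_coef (p (+) q) k (m + n) =
    (coefLG p q (m + k) n)%:~R * shift_coef p k m +
    (coefLG p q m (n + k))%:~R * shift_coef q k n.
Proof.
move=> mnk; case: half_D => _ _ H.
have := H p q _ _ (@LV_part_LG K p m) (@LV_part_LG K q n).
rewrite /= LV_bracketE D_Z expr0 scale1r.
move=> /(congr1 (LGcoef (p (+) q) (m + n + k))).
rewrite !LGcoefZ LGcoefD LGcoef_bracketl // LGcoef_bracketr //.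
have -> : m + n + k - n = m + k by rewrite addrAC addrK.
have -> : m + n + k - m = n + k by rewrite -(addrA m) addrAC subrr add0r.
rewrite -!/(shift_coef _ _ _) -mulrA => ->.
by rewrite mulrA mulfV ?mul1r // pnatr_eq0.
Qed.

(** At [m + n + k = 0], outside the reach of [shift_coefE], one has [m + k = - n] and [n + k = - m],
    so both sides vanish. *)
Lemma shift_coef_half_der k : half_der_rel K k (shift_coef false k).
Proof.
move=> m n; have [mnk|] := eqVneq (m + n + k) 0; last first.
  exact: (shift_coefE false false).
rewrite shift_coefN // mulr0.
have -> : m + k = - n by apply/eqP; rewrite -addr_eq0 addrAC mnk.
have -> : n + k = - m by apply/eqP; rewrite -addr_eq0 addrC addrA mnk.
have -> : det2 n (- n) = 0 by rewrite /det2 /=; ring.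
have -> : det2 (- m) m = 0 by rewrite /det2 /=; ring.
by rewrite !mul0r addr0.
Qed.

(** Where [m + k] or [n + k] is 0, so that [coefLG] drops a term, the corresponding coefficient is 0
    as well. *)
Lemma shift_coef_odd k m n : m != 0 -> n != 0 -> m + n + k != 0 ->
  2 * shift_coef false k (m + n) = shift_coef true k m + shift_coef true k n.
Proof.
move=> m0 n0 /(shift_coefE true true); rewrite /coefLG /= m0 n0 /= mulr1 => ->.
congr (_ + _).
- by have [/shift_coefN ->|_] := eqVneq (m + k) 0; rewrite ?mulr0 ?mul1r.
- by have [/shift_coefN ->|_] := eqVneq (n + k) 0; rewrite ?mulr0 ?mul1r.
Qed.

Let double_neq0 m : m != 0 -> m + m != 0.
Proof.
apply: contraNneq => E; apply/eqP; case: m E => m1 m2 [] E1 E2.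
by congr (_, _); lia.
Qed.

Lemma shift_coef_nonzero p k m : k != 0 -> shift_coef p k m = 0.
Proof.
move=> k0.
have even0 := half_der_eq0 K k _ (shift_coef_half_der k) k0 (shift_coef0 _ _).
case: p; last exact: even0.
have [->|m0] := eqVneq m 0; first exact: shift_coef0.
have double0 n : n != 0 -> n + n + k != 0 -> shift_coef true k n = 0.
  move=> n0 nk; have := shift_coef_odd k n n n0 n0 nk.
  rewrite even0 mulr0 => /esym/eqP.
  by rewrite -mulr2n mulrn_eq0 => /eqP.
(* For [k = - 2m] the pair [m, m] gives no information; the pair [m, 2m] is used instead, with
   [double0] covering [2m]. *)
have [mk|] := eqVneq (m + m + k) 0; last exact: double0.
have mm0 := double_neq0 _ m0.
have := shift_coef_odd k m (m + m) m0 mm0.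
rewrite -addrA mk addr0 even0 mulr0 => /(_ m0).
by rewrite [shift_coef true k (m + m)]double0 ?addr0 // -addrA mk addr0.
Qed.

(** The pair [m, m] equates the odd value at [m] with the even one at [2m], which is the
    constant. *)
Lemma shift_coef_zero p m : m != 0 ->
  shift_coef p 0 m = shift_coef false 0 (1, 1).
Proof.
have even_c := half_der_const K _ (shift_coef_half_der 0).
move=> m0; case: p; last exact: even_c.
have mm0 := double_neq0 _ m0.
have := shift_coef_odd 0 m m m0 m0; rewrite addr0 => /(_ mm0).
have -> : shift_coef true 0 m + shift_coef true 0 m =
    2 * shift_coef true 0 m by ring.
rewrite even_c // => /mulfI -> //.
by rewrite pnatr_eq0.
Qed.

Lemma half_superderivation_scalar : exists c : K, forall x, D x = c *: x.
Proof.
exists (shift_coef false 0 (1, 1)).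
set c := shift_coef _ _ _.
have lin_c : linear (fun x : LV_carrier K => c *: x).
  by move=> b x y; rewrite scalerDr !scalerA mulrC.
have on_LG p m : D (LG K p m) = c *: (LG K p m : LV_carrier K).
  apply: (LGcoef_eq p) => [||v]; first exact: D_part.
    exact/LV_partZ/LV_part_LG.
  (* Every index is a shift of [m], so each coefficient of [D (LG K p m)] is a [shift_coef]. *)
  have -> : v = m + (v - m) by rewrite subrKC.
  rewrite -/(shift_coef p (v - m) m) LGcoefZ LGcoef_LG eqxx.
  have [->|m0] := eqVneq m 0; first by rewrite shift_coef0 andbF mulr0.
  have [->|vm] := eqVneq v m.
    by rewrite subrr addr0 eqxx mulr1 shift_coef_zero.
  rewrite shift_coef_nonzero ?subr_eq0 //.
  by rewrite subrKC (negbTE vm) mulr0.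
move=> x; have [x0 [x1 [p0 p1 ->]]] := LV_part_cover x.
have DD y z : D (y + z) = D y + D z.
  by have := D_linear 1 y z; rewrite !scale1r.
rewrite DD scalerDr; congr (_ + _).
- exact: (LV_part_ext _ _ _ _ D_linear lin_c (on_LG false) _ p0).
- exact: (LV_part_ext _ _ _ _ D_linear lin_c (on_LG true) _ p1).
Qed.

End EvenHalfSuperderivation.

(** The two terms on the right are equal and the half averages them; this puts scalar maps in
    [Delta_even]. *)
Lemma LV_bracket_scale_mean (c : K) x y :
  c *: LV_bracket x y =
    2^-1 *: (LV_bracket (c *: x) y + LV_bracket x (c *: y)).
Proof.
have -> : LV_bracket (c *: x) y = c *: LV_bracket x y.
  exact: (GRing.scalable_linear (@LV_bracket_linearl _ y)).
have -> : LV_bracket x (c *: y) = c *: LV_bracket x y.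
  exact: (GRing.scalable_linear (@LV_bracket_linearr _ x)).
by rewrite -mulr2n -scaler_nat scalerA mulVf ?scale1r // pnatr_eq0.
Qed.

End KantorDoubleCoefficients.

Theorem theorem4p3 (R : realType) :
  Delta_even (LV R[i]) =
    [set c *: (idfun : LV R[i] -> LV R[i]) | c in [set: R[i]]] /\
  (idfun : LV R[i] -> LV R[i]) <> 0.
Proof.
split.
  apply/seteqP; split => [D /half_superderivation_scalar [c Dc]|_ [c _ <-]].
    by exists c => //; apply/funext => x; rewrite Dc.
  split.
  - move=> b x y; change (c *: (b *: x + y) = b *: (c *: x) + c *: y).
    by rewrite scalerDr !scalerA mulrC.
  - by move=> p x px; apply: LV_partZ.
  - move=> p q x y _ _.
    rewrite expr0 scale1r; exact: LV_bracket_scale_mean.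
(* The identity is nonzero: [L_(1,1)] has coefficient 1 at [(1, 1)]. *)
have u0 : ((1, 1) : int * int) != 0 by [].
move=> /(congr1 (fun f => LGcoef _ false (1, 1) (f (LG R[i] false (1, 1))))).
change (LGcoef _ false (1, 1) (LG R[i] false (1, 1)) =
  LGcoef _ false (1, 1) 0 -> False).
rewrite LGcoef_LG !eqxx u0 /LGcoef; case: insub => [u|] /eqP.
  by rewrite mcoeff0 oner_eq0.
by rewrite oner_eq0.
Qed.
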